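(* Let $(V;\mathcal L,\mathcal R,\rho)$ be a representation of a coherent noncommutative Poisson algebra $(P,\cdot_P,\{-,-\}_P)$ satisfying $\rho(x\cdot_Py)=\rho(x)\mathcal L_y+\rho(y)\mathcal R_x$ for all $x,y\in P$. Let $T:V\to P$ be a linear map, identified with an element of $(P\ltimes_{(-\mathcal R^*,-\mathcal L^*,\rho^* )}V^* )\otimes(P\ltimes_{(-\mathcal R^*,-\mathcal L^*,\rho^* )}V^* )$. Then $\overline T=T-\tau(T)$ is a skew-symmetric solution of the Poisson Yang-Baxter equation in $P\ltimes_{(-\mathcal R^*,-\mathcal L^*,\rho^* )}V^*$ if and only if $T$ is an $\mathcal O$-operator on $P$ with respect to the representation $(V;\mathcal L,\mathcal R,\rho)$.
   Context: All vector spaces are finite dimensional over an algebraically closed field of characteristic $0$. A noncommutative Poisson algebra $(P,\cdot_P,\{-,-\}_P)$ is a vector space with an associative (not necessarily commutative) product and a Lie bracket such that $\{x,y\cdot_Pz\}_P=\{x,y\}_P\cdot_Pz+y\cdot_P\{x,z\}_P$. It is coherent if $\{x,y\cdot_Pz\}_P+\{y,z\cdot_Px\}_P+\{z,x\cdot_Py\}_P=0$ for all $x,y,z$. A representation of $P$ is $(V;\mathcal L,\mathcal R,\rho)$ with linear maps $\mathcal L,\mathcal R,\rho:P\to\mathfrak{gl}(V)$ such that for all $x,y$: $\mathcal L_{x\cdot_P y}=\mathcal L_x\mathcal L_y$, $\mathcal R_{x\cdot_P y}=\mathcal R_y\mathcal R_x$, $\mathcal L_x\mathcal R_y=\mathcal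 R_y\mathcal L_x$, $\rho(\{x,y\}_P)=[\rho(x),\rho(y)]$, $\mathcal L_{\{x,y\}_P}=\rho(x)\mathcal L_y-\mathcal L_y\rho(x)$, $\mathcal R_{\{x,y\}_P}=\rho(x)\mathcal R_y-\mathcal R_y\rho(x)$, $\rho(x\cdot_Py)=\mathcal L_x\rho(y)+\mathcal R_y\rho(x)$. For a linear $\mu:P\to\mathfrak{gl}(V)$, $\mu^*:P\to\mathfrak{gl}(V^* )$ is $\langle\mu^*_x\alpha,v\rangle=-\langle\alpha,\mu_xv\rangle$. For a representation $(W;\mathcal L',\mathcal R',\rho')$ the semi-direct product $P\ltimes_{(\mathcal L',\mathcal R',\rho')}W$ is $P\oplus W$ with $(x_1+w_1)\cdot(x_2+w_2)=x_1\cdot_Px_2+\mathcal L'_{x_1}w_2+\mathcal R'_{x_2}w_1$ and $\{x_1+w_1,x_2+w_2\}=\{x_1,x_2\}_P+\rho'(x_1)w_2-\rho'(x_2)w_1$. Under the hypotheses, $(V^*;-\mathcal R^*,-\mathcal L^*,\rho^* )$ is a representation and the semi-direct product $P\ltimes_{(-\mathcal R^*,-\mathcal L^*,\rho^* )}V^*$ is a coherent noncommutative Poisson algebra. $T$ is identified with a tensor through $\mathrm{Hom}(V,P)\cong P\otimes V^*\subset(P\oplus V^* )\otimes(P\oplus V^* )$, i.e. $T=\sum_iT(v_i)\otimes v_i^*$ for a basis $\{v_i\}$ of $V$ with dual basis $\{v_i^*\}$; $\tau(a\otimes b)=b\otimes a$. (Using $V^*\otimes P$ instead only changes the sign of $\overline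 T$.) $T:V\to P$ is an $\mathcal O$-operator on $P$ with respect to $(V;\mathcal L,\mathcal R,\rho)$ if for all $u,v\in V$: $T(u)\cdot_PT(v)=T(\mathcal L_{T(u)}v+\mathcal R_{T(v)}u)$ and $\{T(u),T(v)\}_P=T\big(\rho(T(u))(v)-\rho(T(v))(u)\big)$. For a coherent noncommutative Poisson algebra $Q$ and $r=\sum_ia_i\otimes b_i\in Q\otimes Q$, the Poisson Yang-Baxter equation is $\mathbf A(r)=\mathbf C(r)=0$, where $\mathbf A(r)=\sum_{i,j}(a_ia_j\otimes b_i\otimes b_j+a_i\otimes a_j\otimes b_ib_j-a_j\otimes a_ib_j\otimes b_i)$ and $\mathbf C(r)=\sum_{i,j}(\{a_i,a_j\}\otimes b_i\otimes b_j+a_i\otimes\{b_i,a_j\}\otimes b_j+a_i\otimes a_j\otimes\{b_i,b_j\})$. *)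

(* Defs.v *)
From HB Require Import structures.
From mathcomp Require Import all_boot all_order all_algebra.
From mathcomp Require Import ring.

Set Implicit Arguments.
Unset Strict Implicit.
Unset Printing Implicit Defensive.

Import GRing.Theory.
Local Open Scope ring_scope.

Definition dual (K : fieldType) (V : vectType K) : vectType K := 'Hom(V, K^o).

Section Multilinear.
Variables (K : fieldType).
Implicit Types P U V W Z : vectType K.

Definition is_bilinear U W Z (f : U -> W -> Z) : Prop :=
  bilinear_for *:%R *:%R f.

(* [linfun f] is the linear map f only if f is linear. *)
Lemma linfunE U W (f : U -> W) : linear f -> linfun f =1 f.
Proof.
move=> lf; pose h := GRing.isLinear.Build K U W *:%R f lf.
pose g : {linear U -> W} := HB.pack f h.
exact: (lfunE g).
Qed.

Lemma bilinDl U W Z (f : U -> W -> Z) : is_bilinear f ->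
  forall u u' w, f (u + u') w = f u w + f u' w.
Proof. by move=> [h _] u u' w; have /= := h w 1 u u'; rewrite !scale1r. Qed.

Lemma bilinDr U W Z (f : U -> W -> Z) : is_bilinear f ->
  forall u w w', f u (w + w') = f u w + f u w'.
Proof. by move=> [_ h] u w w'; have /= := h u 1 w w'; rewrite !scale1r. Qed.

Lemma bilin0l U W Z (f : U -> W -> Z) : is_bilinear f -> forall w, f 0 w = 0.
Proof. by move=> h w; apply: (addrI (f 0 w)); rewrite -bilinDl // !addr0. Qed.

Lemma bilin0r U W Z (f : U -> W -> Z) : is_bilinear f -> forall u, f u 0 = 0.
Proof. by move=> h u; apply: (addrI (f u 0)); rewrite -bilinDr // !addr0. Qed.

Lemma bilinZl U W Z (f : U -> W -> Z) : is_bilinear f ->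
  forall a u w, f (a *: u) w = a *: f u w.
Proof.
move=> hf a u w; have /= := hf.1 w a u 0.
by rewrite /= addr0 bilin0l // addr0.
Qed.

Lemma bilinZr U W Z (f : U -> W -> Z) : is_bilinear f ->
  forall a u w, f u (a *: w) = a *: f u w.
Proof.
move=> hf a u w; have /= := hf.2 u a w 0.
by rewrite /= addr0 bilin0r // addr0.
Qed.

Lemma bilin_suml U W Z (f : U -> W -> Z) : is_bilinear f ->
  forall n (u : 'I_n -> U) w, f (\sum_i u i) w = \sum_i f (u i) w.
Proof.
move=> hf n u w; apply: (big_morph (fun x => f x w)); last exact: bilin0l.
by move=> x y; apply: bilinDl.
Qed.

Lemma bilin_sumr U W Z (f : U -> W -> Z) : is_bilinear f ->
  forall n u (w : 'I_n -> W), f u (\sum_i w i) = \sum_i f u (w i).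
Proof.
move=> hf n u w; apply: (big_morph (f u)); last exact: bilin0r.
by move=> x y; apply: bilinDr.
Qed.

(* In finite dimension U ⊗ W is Hom(U^*, W), with u ⊗ w the map
   f |-> f(u) w.  Lemmas [tens_bilinear], [tensor_decomp] and [tliftE] give
   its universal property; [tlift f] is the linear map induced by f. *)
Definition tensor U W : vectType K := 'Hom(dual U, W).

Definition tens U W (u : U) (w : W) : tensor U W :=
  linfun (fun f : dual U => (f u : K) *: w).

Definition basis_vec U (i : 'I_(\dim {:U})) : U := (vbasis {:U})`_i.

Definition dual_vec U (i : 'I_(\dim {:U})) : dual U :=
  linfun (coord (vbasis {:U}) i : U -> K^o).

Definition tlift U W Z (f : U -> W -> Z) (r : tensor U W) : Z :=
  \sum_(i < \dim {:U}) f (basis_vec i) (r (dual_vec i)).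

Lemma dual_vecE U i (u : U) : dual_vec i u = coord (vbasis {:U}) i u.
Proof.
rewrite /dual_vec linfunE // => a x y.
by rewrite linearP.
Qed.

Lemma basis_decomp U (u : U) : u = \sum_i (dual_vec i u : K) *: basis_vec i.
Proof.
rewrite {1}(coord_vbasis (memvf u)).
by apply: eq_bigr => i _; rewrite dual_vecE.
Qed.

Lemma tensE U W (u : U) (w : W) (f : dual U) : tens u w f = (f u : K) *: w.
Proof.
rewrite /tens linfunE // => a g h.
by rewrite add_lfunE scale_lfunE scalerDl scalerA.
Qed.

Lemma tens_bilinear U W : is_bilinear (@tens U W).
Proof.
split=> [w a u u'|u a w w'] /=; apply/lfunP => f; rewrite add_lfunE scale_lfunE !tensE.
  by rewrite linearP scalerDl scalerA.
by rewrite scalerDr !scalerA mulrC.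
Qed.

Lemma tensor_decomp U W (r : tensor U W) :
  r = \sum_(i < \dim {:U}) tens (basis_vec i) (r (dual_vec i)).
Proof.
apply/lfunP => f; rewrite sum_lfunE.
have -> : f = \sum_i (f (basis_vec i) : K) *: (dual_vec i : dual U).
  apply/lfunP => u; rewrite sum_lfunE {1}(basis_decomp u) linear_sum.
  apply: eq_bigr => i _; rewrite linearZ scale_lfunE /=.
  exact: mulrC.
rewrite linear_sum; apply: eq_bigr => i _; rewrite linearZ tensE.
congr (_ *: _); rewrite sum_lfunE (bigD1 i) //= big1 ?addr0.
  rewrite scale_lfunE dual_vecE coord_free ?eqxx; first by rewrite /GRing.scale /= mulr1.
  exact: basis_free (vbasisP _).
move=> j neq_ji; rewrite scale_lfunE dual_vecE coord_free.
  by rewrite eq_sym (negbTE neq_ji) /GRing.scale /= mulr0.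
exact: basis_free (vbasisP _).
Qed.

Lemma tlift_linear U W Z (f : U -> W -> Z) : is_bilinear f -> linear (tlift f).
Proof.
move=> hf a r s; rewrite /tlift scaler_sumr -big_split /=.
apply: eq_bigr => i _.
by rewrite add_lfunE scale_lfunE (bilinDr hf) (bilinZr hf).
Qed.

Lemma tliftE U W Z (f : U -> W -> Z) : is_bilinear f ->
  forall u w, tlift f (tens u w) = f u w.
Proof.
move=> hf u w; rewrite /tlift [in RHS](basis_decomp u) (bilin_suml hf).
by apply: eq_bigr => i _; rewrite tensE (bilinZl hf) (bilinZr hf).
Qed.

Lemma tlift_sum U W Z (f : U -> W -> Z) : is_bilinear f ->
  forall n (a : 'I_n -> U) (b : 'I_n -> W),
  tlift f (\sum_i tens (a i) (b i)) = \sum_i f (a i) (b i).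
Proof.
move=> hf n a b; have lf := tlift_linear hf.
have -> : tlift f =1 linfun (tlift f) by move=> r; rewrite linfunE.
rewrite linear_sum; apply: eq_bigr => i _.
by rewrite /= (linfunE lf) tliftE.
Qed.

Definition tswap U W (r : tensor U W) : tensor W U :=
  tlift (fun a b => tens b a) r.

Lemma tswapE U W (u : U) (w : W) : tswap (tens u w) = tens w u.
Proof.
rewrite /tswap tliftE //; split=> [x a y z|x a y z] /=.
  exact: (tens_bilinear W U).2.
exact: (tens_bilinear W U).1.
Qed.

Definition dual_map P V (mu : 'Hom(P, 'End(V))) : 'Hom(P, 'End(dual V)) :=
  linfun (fun x => linfun (fun f : dual V => - (f \o mu x)%VF)).

Lemma dual_mapE P V (mu : 'Hom(P, 'End(V))) x (f : dual V) v :
  dual_map mu x f v = - f (mu x v).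
Proof.
have lin1 y : linear (fun g : dual V => - (g \o mu y)%VF).
  move=> a g h; apply/lfunP => w.
  by rewrite !(opp_lfunE, add_lfunE, scale_lfunE, comp_lfunE) opprD scalerN.
have lin2 : linear (fun y => linfun (fun g : dual V => - (g \o mu y)%VF)).
  move=> a y z; apply/lfunP => g; apply/lfunP => w.
  rewrite !(add_lfunE, scale_lfunE) !(linfunE (lin1 _)).
  rewrite !(opp_lfunE, add_lfunE, scale_lfunE, comp_lfunE).
  by rewrite !linearP /= add_lfunE scale_lfunE linearP opprD scalerN.
by rewrite /dual_map (linfunE lin2) (linfunE (lin1 _)) opp_lfunE comp_lfunE.
Qed.

End Multilinear.

Arguments tens {K U W}.
Arguments basis_vec {K U}.
Arguments dual_vec {K U}.

Lemma scalar_eq (K : fieldType) (V : vectType K) (u v : V) :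
  (forall f : {scalar V}, f u = f v) -> u = v.
Proof.
move=> E; rewrite (coord_vbasis (memvf u)) (coord_vbasis (memvf v)).
by apply: eq_bigr => i _; rewrite E.
Qed.

Ltac abelian :=
  apply: scalar_eq => ?;
  rewrite ?(linearD, linearN, linearZ, linear0) /=; ring.

Section Poisson.
Variables (K : fieldType).

Record ncPoisson (P : vectType K) : Type := NCPoisson {
  pmul : P -> P -> P;
  pbr : P -> P -> P;
  pmul_bilinear : is_bilinear pmul;
  pbr_bilinear : is_bilinear pbr;
  pmulA : forall x y z, pmul x (pmul y z) = pmul (pmul x y) z;
  pbrxx : forall x, pbr x x = 0;
  pbr_jacobi : forall x y z,
    pbr x (pbr y z) + pbr y (pbr z x) + pbr z (pbr x y) = 0;
  pbr_leibniz : forall x y z,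
    pbr x (pmul y z) = pmul (pbr x y) z + pmul y (pbr x z) }.

Definition coherent (P : vectType K) (A : ncPoisson P) : Prop :=
  forall x y z : P,
    pbr A x (pmul A y z) + pbr A y (pmul A z x) + pbr A z (pmul A x y) = 0.

Record representation (P : vectType K) (A : ncPoisson P) (V : vectType K) :
    Type := Representation {
  repL : 'Hom(P, 'End(V));
  repR : 'Hom(P, 'End(V));
  rep_rho : 'Hom(P, 'End(V));
  repLM : forall x y, repL (pmul A x y) = (repL x \o repL y)%VF;
  repRM : forall x y, repR (pmul A x y) = (repR y \o repR x)%VF;
  repLR : forall x y, (repL x \o repR y)%VF = (repR y \o repL x)%VF;
  rep_rhoB : forall x y, rep_rho (pbr A x y) =
    (rep_rho x \o rep_rho y)%VF - (rep_rho y \o rep_rho x)%VF;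
  repLB : forall x y, repL (pbr A x y) =
    (rep_rho x \o repL y)%VF - (repL y \o rep_rho x)%VF;
  repRB : forall x y, repR (pbr A x y) =
    (rep_rho x \o repR y)%VF - (repR y \o rep_rho x)%VF;
  rep_rhoM : forall x y, rep_rho (pmul A x y) =
    (repL x \o rep_rho y)%VF + (repR y \o rep_rho x)%VF }.

Definition rho_compatible (P : vectType K) (A : ncPoisson P) (V : vectType K)
    (M : representation A V) : Prop :=
  forall x y, rep_rho M (pmul A x y) =
    (rep_rho M x \o repL M y)%VF + (rep_rho M y \o repR M x)%VF.

Section DualRepresentation.
Variables (P : vectType K) (A : ncPoisson P) (V : vectType K).
Variables (M : representation A V) (hM : rho_compatible M).

Let dL := - dual_map (repR M).
Let dR := - dual_map (repL M).
Let dr := dual_map (rep_rho M).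

Let dLE x f v : dL x f v = f (repR M x v).
Proof. by rewrite /dL !opp_lfunE dual_mapE opprK. Qed.
Let dRE x f v : dR x f v = f (repL M x v).
Proof. by rewrite /dR !opp_lfunE dual_mapE opprK. Qed.
Let drE x f v : dr x f v = - f (rep_rho M x v).
Proof. by rewrite /dr dual_mapE. Qed.

Let fE := (comp_lfunE, add_lfunE, opp_lfunE, dLE, dRE, drE).

Fact dual_repLM x y : dL (pmul A x y) = (dL x \o dL y)%VF.
Proof. by apply/lfunP=> f; apply/lfunP=> v; rewrite !fE repRM !fE. Qed.
Fact dual_repRM x y : dR (pmul A x y) = (dR y \o dR x)%VF.
Proof. by apply/lfunP=> f; apply/lfunP=> v; rewrite !fE repLM !fE. Qed.
Fact dual_repLR x y : (dL x \o dR y)%VF = (dR y \o dL x)%VF.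
Proof.
apply/lfunP=> f; apply/lfunP=> v; rewrite !fE; congr (f _).
by have /lfunP/(_ v) := repLR M y x; rewrite !fE.
Qed.
Fact dual_rep_rhoB x y :
  dr (pbr A x y) = (dr x \o dr y)%VF - (dr y \o dr x)%VF.
Proof.
apply/lfunP=> f; apply/lfunP=> v; rewrite !fE rep_rhoB !fE.
by rewrite linearB /= !opprK opprB.
Qed.
Fact dual_repLB x y :
  dL (pbr A x y) = (dr x \o dL y)%VF - (dL y \o dr x)%VF.
Proof.
apply/lfunP=> f; apply/lfunP=> v; rewrite !fE repRB !fE.
by rewrite linearB /= opprK addrC.
Qed.
Fact dual_repRB x y :
  dR (pbr A x y) = (dr x \o dR y)%VF - (dR y \o dr x)%VF.
Proof.
apply/lfunP=> f; apply/lfunP=> v; rewrite !fE repLB !fE.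
by rewrite linearB /= opprK addrC.
Qed.
Fact dual_rep_rhoM x y :
  dr (pmul A x y) = (dL x \o dr y)%VF + (dR y \o dr x)%VF.
Proof.
apply/lfunP=> f; apply/lfunP=> v; rewrite !fE hM !fE.
by rewrite linearD /= opprD addrC.
Qed.

Definition dual_rep : representation A (dual V) :=
  @Representation P A (dual V)
    (- dual_map (repR M)) (- dual_map (repL M)) (dual_map (rep_rho M))
    dual_repLM dual_repRM dual_repLR
    dual_rep_rhoB dual_repLB dual_repRB dual_rep_rhoM.

End DualRepresentation.

Section SemiDirect.
Variables (P : vectType K) (A : ncPoisson P) (W : vectType K).
Variable M : representation A W.

Let Q : vectType K := (P * W)%type.

Definition sd_mul (p q : Q) : Q :=
  (pmul A p.1 q.1, repL M p.1 q.2 + repR M q.1 p.2).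

Definition sd_br (p q : Q) : Q :=
  (pbr A p.1 q.1, rep_rho M p.1 q.2 - rep_rho M q.1 p.2).

Let fE := (comp_lfunE, add_lfunE, opp_lfunE, scale_lfunE).

Fact sd_mul_bilinear : is_bilinear sd_mul.
Proof.
split=> [q a p p'|p a q q'] /=; rewrite /sd_mul; congr (_, _) => /=.
- exact: (pmul_bilinear A).1.
- by rewrite !(linearD, linearZ) /= !fE; abelian.
- exact: (pmul_bilinear A).2.
- by rewrite !(linearD, linearZ) /= !fE; abelian.
Qed.

Fact sd_br_bilinear : is_bilinear sd_br.
Proof.
split=> [q a p p'|p a q q'] /=; rewrite /sd_br; congr (_, _) => /=.
- exact: (pbr_bilinear A).1.
- by rewrite !(linearD, linearZ) /= !fE; abelian.
- exact: (pbr_bilinear A).2.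
- by rewrite !(linearD, linearZ) /= !fE; abelian.
Qed.

Fact sd_mulA x y z : sd_mul x (sd_mul y z) = sd_mul (sd_mul x y) z.
Proof.
rewrite /sd_mul /= pmulA; congr (_, _).
rewrite !linearD /= repLM repRM !fE -addrA; congr (_ + (_ + _)).
by have /lfunP/(_ y.2) := repLR M x.1 z.1; rewrite !fE.
Qed.

Fact sd_brxx x : sd_br x x = 0.
Proof. by rewrite /sd_br pbrxx subrr. Qed.

Fact sd_br_jacobi x y z :
  sd_br x (sd_br y z) + sd_br y (sd_br z x) + sd_br z (sd_br x y) = 0.
Proof.
rewrite /sd_br /=; congr (_, _) => /=; first exact: pbr_jacobi.
rewrite !linearB /= !rep_rhoB !fE !opprB.
abelian.
Qed.

Fact sd_br_leibniz x y z :
  sd_br x (sd_mul y z) = sd_mul (sd_br x y) z + sd_mul y (sd_br x z).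
Proof.
rewrite /sd_br /sd_mul /=; congr (_, _) => /=; first exact: pbr_leibniz.
rewrite !(linearD, linearB) /= repLB repRB rep_rhoM !fE.
abelian.
Qed.

Definition semidirect : ncPoisson Q :=
  NCPoisson sd_mul_bilinear sd_br_bilinear sd_mulA
    sd_brxx sd_br_jacobi sd_br_leibniz.

End SemiDirect.

Lemma semidirect_dual_coherent (P V : vectType K) (A : ncPoisson P)
    (M : representation A V) (hM : rho_compatible M) :
  coherent A -> coherent (semidirect (dual_rep hM)).
Proof.
move=> cA x y z; congr (_, _) => /=; first exact: cA.
apply/lfunP => v; rewrite /= !(linearD, linearB) /=.
rewrite !(zero_lfunE, add_lfunE, opp_lfunE, dual_mapE) !rep_rhoM.
rewrite !(add_lfunE, comp_lfunE, linearD) /=.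
abelian.
Qed.

Definition O_operator (P V : vectType K) (A : ncPoisson P)
    (M : representation A V) (T : 'Hom(V, P)) : Prop :=
  forall u v : V,
    pmul A (T u) (T v) = T (repL M (T u) v + repR M (T v) u) /\
    pbr A (T u) (T v) = T (rep_rho M (T u) v - rep_rho M (T v) u).

Section YangBaxter.
Variables (Q : vectType K) (A : ncPoisson Q).

Definition A_term (a b a' b' : Q) : tensor Q (tensor Q Q) :=
  tens (pmul A a a') (tens b b') + tens a (tens a' (pmul A b b'))
  - tens a' (tens (pmul A a b') b).

Definition C_term (a b a' b' : Q) : tensor Q (tensor Q Q) :=
  tens (pbr A a a') (tens b b') + tens a (tens (pbr A b a') b')
  + tens a (tens a' (pbr A b b')).

Definition YB_A (r : tensor Q Q) : tensor Q (tensor Q Q) :=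
  tlift (fun a b => tlift (fun a' b' => A_term a b a' b') r) r.

Definition YB_C (r : tensor Q Q) : tensor Q (tensor Q Q) :=
  tlift (fun a b => tlift (fun a' b' => C_term a b a' b') r) r.

Definition quadrilinear (f : Q -> Q -> Q -> Q -> tensor Q (tensor Q Q)) :=
  (forall a b, is_bilinear (f a b)) /\
  (forall a' b', is_bilinear (fun a b => f a b a' b')).

Fact A_term_quadrilinear : quadrilinear A_term.
Proof.
have mDl := bilinDl (pmul_bilinear A); have mDr := bilinDr (pmul_bilinear A).
have mZl := bilinZl (pmul_bilinear A); have mZr := bilinZr (pmul_bilinear A).
have t3 := tens_bilinear Q (tensor Q Q); have t2 := tens_bilinear Q Q.
have E := (mDl, mDr, mZl, mZr, bilinDl t3, bilinDr t3, bilinZl t3, bilinZr t3,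
  bilinDl t2, bilinDr t2, bilinZl t2, bilinZr t2).
by split=> x y; split=> u c v w /=; rewrite /A_term !E; abelian.
Qed.

Fact C_term_quadrilinear : quadrilinear C_term.
Proof.
have mDl := bilinDl (pbr_bilinear A); have mDr := bilinDr (pbr_bilinear A).
have mZl := bilinZl (pbr_bilinear A); have mZr := bilinZr (pbr_bilinear A).
have t3 := tens_bilinear Q (tensor Q Q); have t2 := tens_bilinear Q Q.
have E := (mDl, mDr, mZl, mZr, bilinDl t3, bilinDr t3, bilinZl t3, bilinZr t3,
  bilinDl t2, bilinDr t2, bilinZl t2, bilinZr t2).
by split=> x y; split=> u c v w /=; rewrite /C_term !E; abelian.
Qed.

Fact quadrilinear_tlift f (r : tensor Q Q) : quadrilinear f ->
  is_bilinear (fun a b => tlift (fun a' b' => f a b a' b') r).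
Proof.
move=> [_ hf]; split=> u c v w /=; rewrite /tlift scaler_sumr -big_split /=;
  apply: eq_bigr => i _; [exact: (hf _ _).1|exact: (hf _ _).2].
Qed.

Lemma YB_AE n (a b : 'I_n -> Q) :
  YB_A (\sum_i tens (a i) (b i)) =
  \sum_i \sum_j (tens (pmul A (a i) (a j)) (tens (b i) (b j))
    + tens (a i) (tens (a j) (pmul A (b i) (b j)))
    - tens (a j) (tens (pmul A (a i) (b j)) (b i))).
Proof.
rewrite /YB_A tlift_sum; last exact: quadrilinear_tlift A_term_quadrilinear.
by apply: eq_bigr => i _; rewrite tlift_sum //; apply: A_term_quadrilinear.1.
Qed.

Lemma YB_CE n (a b : 'I_n -> Q) :
  YB_C (\sum_i tens (a i) (b i)) =
  \sum_i \sum_j (tens (pbr A (a i) (a j)) (tens (b i) (b j))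
    + tens (a i) (tens (pbr A (b i) (a j)) (b j))
    + tens (a i) (tens (a j) (pbr A (b i) (b j)))).
Proof.
rewrite /YB_C tlift_sum; last exact: quadrilinear_tlift C_term_quadrilinear.
by apply: eq_bigr => i _; rewrite tlift_sum //; apply: C_term_quadrilinear.1.
Qed.

Definition PYBE (r : tensor Q Q) : Prop := YB_A r = 0 /\ YB_C r = 0.

Definition skew_symmetric (r : tensor Q Q) : Prop := tswap r = - r.

End YangBaxter.

(* The image of T under Hom(V, P) = P ⊗ V' -> (P ⊕ V') ⊗ (P ⊕ V') for V' the
   dual of V. *)
Definition hom_tensor (P V : vectType K) (T : 'Hom(V, P)) :
    tensor (P * dual V)%type (P * dual V)%type :=
  \sum_(i < \dim {:V})
    tens ((T (basis_vec i), 0) : P * dual V) ((0, dual_vec i) : P * dual V).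

(* [hom_tensor] does not depend on the basis used to define it. *)
Lemma hom_tensorE (P V : vectType K) (T : 'Hom(V, P))
    (X : (\dim {:V}).-tuple V) : basis_of {:V} X ->
  hom_tensor T = \sum_(i < \dim {:V})
    tens ((T X`_i, 0) : P * dual V)
         ((0, linfun (coord X i : V -> K^o)) : P * dual V).
Proof.
move=> bX; apply/lfunP => f; rewrite !sum_lfunE.
pose j (p : P) : (P * dual V)%type := (p, 0).
have jD p q : j (p + q) = j p + j q by congr (_, _); rewrite /= addr0.
have jZ c p : j (c *: p) = c *: j p by congr (_, _); rewrite /= scaler0.
have lg : linear (fun v : V => f (j (T v)) : K^o).
  by move=> c u v; rewrite linearP jD jZ linearP.
pose g : dual V := linfun (fun v : V => f (j (T v)) : K^o).
have gE v : g v = f (j (T v)) by rewrite /g linfunE.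
have sumE (F : 'I_(\dim {:V}) -> dual V) :
    \sum_i ((0, F i) : P * dual V) = (0, \sum_i F i).
  pose h (w : dual V) : (P * dual V)%type := (0, w).
  have hD w w' : h (w + w') = h w + h w' by congr (_, _); rewrite /= addr0.
  exact/esym/(big_morph h hD).
have key (Y : (\dim {:V}).-tuple V) : basis_of {:V} Y ->
  \sum_(i < \dim {:V}) tens ((T Y`_i, 0) : P * dual V)
         ((0, linfun (coord Y i : V -> K^o)) : P * dual V) f = (0, g).
  move=> bY.
  transitivity (\sum_(i < \dim {:V})
    ((0, (g Y`_i : K) *: linfun (coord Y i : V -> K^o)) : P * dual V)).
    apply: eq_bigr => i _; rewrite tensE gE; congr (_, _).
    by rewrite /= scaler0.
  rewrite sumE; congr (_, _); apply/lfunP => v; rewrite sum_lfunE.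
  rewrite {2}(coord_basis bY (memvf v)) linear_sum; apply: eq_bigr => i _.
  have lc : linear (coord Y i : V -> K^o) by move=> c u w; rewrite linearP.
  by rewrite scale_lfunE linearZ (linfunE lc); apply: mulrC.
by rewrite [RHS]key //; exact: (key _ (vbasisP _)).
Qed.

End Poisson.

(* Main.v *)
(* A skew-symmetric tensor r, read as a map Q^* -> Q, solves the Poisson
    Yang-Baxter equation iff the cyclic sum of f(r g . r h) vanishes for both
    operations of Q.  A functional on P ⊕ V^* is a pair (α, u) with α in P^* and
    u in V, and Tbar sends it to (- T u, α ∘ T).  With f, g, h = (α, u), (β, v),
    (γ, w), the cyclic sum becomes α(E v w) + β(E w u) + γ(E u v), where E is
    the defect of the O-operator identity for the operation considered. *)
Require Import Defs.
From mathcomp Require Import all_boot all_order all_algebra.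
From mathcomp Require Import ring.

Set Implicit Arguments.
Unset Strict Implicit.
Unset Printing Implicit Defensive.

Import GRing.Theory.
Local Open Scope ring_scope.

(** * Exchanging the legs of a tensor *)

Section TensorSwap.
Variables (K : fieldType) (U W : vectType K).

Lemma tens_flip_bilinear : is_bilinear (fun (u : U) (w : W) => tens w u).
Proof.
split=> [x c y z|x c y z] /=; first exact: (tens_bilinear W U).2.
exact: (tens_bilinear W U).1.
Qed.

Lemma tswap_sum n (a : 'I_n -> U) (b : 'I_n -> W) :
  tswap (\sum_i tens (a i) (b i)) = \sum_i tens (b i) (a i).
Proof. exact: tlift_sum tens_flip_bilinear _ _ _. Qed.

Lemma tswapB (r s : tensor U W) : tswap (r - s) = tswap r - tswap s.
Proof.
have -> : r - s = (-1) *: s + r by rewrite scaleN1r addrC.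
by rewrite /tswap (tlift_linear tens_flip_bilinear) scaleN1r addrC.
Qed.

End TensorSwap.

(** * The Yang-Baxter equation tested on triples of functionals *)

Section TensorEvaluation.
Variables (K : fieldType) (Q : vectType K).
Implicit Types (B : Q -> Q -> Q) (f g h : dual Q).

Lemma tswapK (r : tensor Q Q) : tswap (tswap r) = r.
Proof.
rewrite (tensor_decomp r) [X in tswap X](tswap_sum basis_vec).
exact: tswap_sum.
Qed.

Lemma tens_sumE n (a b : 'I_n -> Q) f :
  (\sum_i tens (a i) (b i)) f = \sum_i (f (a i) : K) *: b i.
Proof. by rewrite sum_lfunE; apply: eq_bigr => i _; rewrite tensE. Qed.

Lemma bilin_sum2 B n (c d : 'I_n -> K) (x y : 'I_n -> Q) f : is_bilinear B ->
  f (B (\sum_i c i *: x i) (\sum_j d j *: y j)) =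
  \sum_i \sum_j (c i * d j * (f (B (x i) (y j)) : K)) :> K.
Proof.
move=> hB; rewrite (bilin_suml hB) linear_sum; apply: eq_bigr => i _.
rewrite (bilin_sumr hB) linear_sum; apply: eq_bigr => j _.
by rewrite (bilinZl hB) (bilinZr hB) !linearZ /= -mulrA.
Qed.

Definition cyclic_sum (r : tensor Q Q) B f g h : K :=
  (f (B (r g) (r h)) : K) + (g (B (r h) (r f)) : K) + (h (B (r f) (r g)) : K).

Lemma dual_separates (q : Q) : (forall f : dual Q, f q = 0 :> K) -> q = 0.
Proof.
by move=> q0; rewrite [q]basis_decomp big1 // => i _; rewrite q0 scale0r.
Qed.

Lemma tensor3_eq0 (X : tensor Q (tensor Q Q)) :
  X = 0 <-> forall f g h, h (X f g) = 0 :> K.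
Proof.
split=> [-> f g h|X0]; first by rewrite !zero_lfunE linear0.
apply/lfunP => f; apply/lfunP => g; rewrite !zero_lfunE.
by apply: dual_separates => h; apply: X0.
Qed.

(** Contracting the first leg of [r] gives the expansion along [b]. Writing [r] as [- tswap r] and
    contracting again gives the expansion along [a], with a sign. *)
Lemma skew_decomp (r : tensor Q Q) : skew_symmetric r ->
  exists n (a b : 'I_n -> Q), [/\ r = \sum_i tens (a i) (b i),
    forall f, r f = \sum_i (f (a i) : K) *: b i &
    forall f, r f = \sum_i (- (f (b i) : K)) *: a i].
Proof.
move=> skew_r; set a := @basis_vec _ Q; set b := fun i => r (dual_vec i).
have rE : r = \sum_i tens (a i) (b i) by exact: tensor_decomp.
exists _, a, b; split=> // f; first by rewrite {1}rE tens_sumE.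
rewrite -[r]opprK -skew_r opp_lfunE {1}rE tswap_sum tens_sumE -sumrN.
by apply: eq_bigr => i _; rewrite scaleNr.
Qed.

Variable A : ncPoisson Q.

Lemma YB_A_eval r f g h : skew_symmetric r ->
  h (YB_A A r f g) = cyclic_sum r (pmul A) f g h :> K.
Proof.
case/skew_decomp=> n [a [b [rE rl rr]]].
have hB := pmul_bilinear A; have sE := bilin_sum2 _ _ _ _ _ hB.
(* Skewness lets each r be expanded along either leg; the choice of leg in each
   product below is the one occurring in the corresponding summand of A(r). *)
have := sE n (fun i => - (g (b i) : K)) (fun i => - (h (b i) : K)) a a f;
  rewrite -!rr => E1.
have := sE n (fun i => - (h (b i) : K)) (fun i => f (a i) : K) a b g;
  rewrite -rr -rl => E2.
have := sE n (fun i => f (a i) : K) (fun i => g (a i) : K) b b h;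
  rewrite -!rl => E3.
rewrite /cyclic_sum E1 E2 E3 rE YB_AE !sum_lfunE linear_sum -!big_split /=.
apply: eq_bigr => i _; rewrite !sum_lfunE linear_sum -!big_split /=.
apply: eq_bigr => j _.
rewrite !(add_lfunE, opp_lfunE, tensE, scale_lfunE).
rewrite !(linearD, linearN, linearZ) /=.
rewrite /GRing.scale /=; ring.
Qed.

Lemma YB_C_eval r f g h : skew_symmetric r ->
  h (YB_C A r f g) = cyclic_sum r (pbr A) f g h :> K.
Proof.
case/skew_decomp=> n [a [b [rE rl rr]]].
have hB := pbr_bilinear A; have sE := bilin_sum2 _ _ _ _ _ hB.
have anti x y : pbr A x y = - pbr A y x.
  apply/eqP; rewrite -addr_eq0; apply/eqP.
  have := pbrxx A (x + y).
  by rewrite (bilinDl hB) !(bilinDr hB) !pbrxx add0r addr0.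
have := sE n (fun i => - (g (b i) : K)) (fun i => - (h (b i) : K)) a a f;
  rewrite -!rr => E1.
have := sE n (fun i => f (a i) : K) (fun i => - (h (b i) : K)) b a g;
  rewrite -rr -rl => E2.
have := sE n (fun i => f (a i) : K) (fun i => g (a i) : K) b b h;
  rewrite -!rl => E3.
(* The middle summand of C(r) pairs to minus [g] of the bracket of [r f] and [r h], so antisymmetry
   is what restores the cyclic order [r h], [r f]. *)
rewrite /cyclic_sum (anti (r h)) linearN /= E1 E2 E3 -sumrN.
rewrite rE YB_CE !sum_lfunE linear_sum -!big_split /=.
apply: eq_bigr => i _; rewrite !sum_lfunE linear_sum -sumrN -!big_split /=.
apply: eq_bigr => j _.
rewrite !(add_lfunE, opp_lfunE, tensE, scale_lfunE).
rewrite !(linearD, linearN, linearZ) /=.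
rewrite /GRing.scale /=; ring.
Qed.

Lemma PYBE_cyclic_sum r : skew_symmetric r ->
  PYBE A r <-> forall f g h,
    cyclic_sum r (pmul A) f g h = 0 /\ cyclic_sum r (pbr A) f g h = 0.
Proof.
move=> skew_r; split=> [[/tensor3_eq0 hA /tensor3_eq0 hC] f g h|H].
  by rewrite -(YB_A_eval _ _ _ skew_r) -(YB_C_eval _ _ _ skew_r).
split; apply/tensor3_eq0 => f g h.
  by rewrite YB_A_eval // (H f g h).1.
by rewrite YB_C_eval // (H f g h).2.
Qed.

End TensorEvaluation.

(** * Functionals on [P * dual V] and the action of [Tbar] on them *)

Section Functionals.
Variables (K : fieldType) (P V : vectType K).
Let Q : vectType K := (P * dual V)%type.

Definition functional (alpha : dual P) (u : V) : dual Q :=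
  linfun (fun q : Q => alpha q.1 + q.2 u).

Lemma functionalE alpha u (q : Q) :
  functional alpha u q = (alpha q.1 : K) + (q.2 u : K) :> K.
Proof.
rewrite /functional linfunE // => c x y /=.
by rewrite linearP add_lfunE scale_lfunE scalerDr addrACA.
Qed.

Lemma functional_surj (f : dual Q) : exists alpha u, f = functional alpha u.
Proof.
have l1 : linear (fun p : P => f ((p, 0) : Q)).
  move=> c x y; rewrite -linearP; congr (f (_, _)).
  by rewrite /= scaler0 addr0.
have l2 : linear (fun a : dual V => f ((0, a) : Q)).
  move=> c x y; rewrite -linearP; congr (f (_, _)).
  by rewrite /= scaler0 addr0.
pose g : dual (dual V) := linfun (fun a : dual V => f ((0, a) : Q)).
exists (linfun (fun p : P => f ((p, 0) : Q))).
(* The restriction of [f] to [dual V] is an element [g] of the bidual; this is the vector of [V]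
   that represents it. *)
exists (\sum_i (g (dual_vec i) : K) *: basis_vec i).
apply/lfunP => -[p a]; rewrite functionalE (linfunE l1) /=.
have -> : f (p, a) = f ((p, 0) : Q) + f ((0, a) : Q).
  by rewrite -linearD; congr (f (_, _)); rewrite /= ?addr0 ?add0r.
congr (_ + _); rewrite -(linfunE l2) -/g.
have {1}-> : a = \sum_i (a (basis_vec i) : K) *: (dual_vec i : dual V).
  apply/lfunP => u; rewrite sum_lfunE {1}(basis_decomp u) linear_sum.
  apply: eq_bigr => i _; rewrite linearZ scale_lfunE /=; exact: mulrC.
rewrite !linear_sum; apply: eq_bigr => i _; rewrite !linearZ /=; exact: mulrC.
Qed.

Variable T : 'Hom(V, P).
Let Tbar := hom_tensor T - tswap (hom_tensor T).

Lemma hom_tensor_skew : skew_symmetric Tbar.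
Proof. by rewrite /skew_symmetric tswapB tswapK opprB. Qed.

(** The first leg of [hom_tensor T] lies in [P], so only [alpha] sees it and the [dual V] component
    results. After the swap the first leg lies in [dual V], so only [u] sees it, and the subtraction
    gives [- T u]. *)
Lemma hom_tensor_functional alpha u :
  Tbar (functional alpha u) = (- T u, (alpha \o T)%VF).
Proof.
rewrite /Tbar /hom_tensor tswap_sum add_lfunE opp_lfunE !tens_sumE.
have sumE n (x : 'I_n -> Q) : \sum_i x i = (\sum_i (x i).1, \sum_i (x i).2).
  by rewrite [LHS]surjective_pairing; congr (_, _);
    [exact: (big_morph (fun q : Q => q.1))|exact: (big_morph (fun q : Q => q.2))].
rewrite !sumE; congr (_, _) => /=.
  rewrite big1 ?add0r => [|i _]; last by rewrite scaler0.
  congr (- _); rewrite {2}(basis_decomp u) linear_sum; apply: eq_bigr => i _.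
  by rewrite functionalE /= linear0 add0r linearZ.
rewrite [X in _ - X]big1 ?subr0 => [|i _]; last by rewrite scaler0.
apply/lfunP => v; rewrite sum_lfunE comp_lfunE {2}(basis_decomp v) !linear_sum.
apply: eq_bigr => i _; rewrite functionalE /= zero_lfunE addr0 scale_lfunE.
by rewrite !linearZ /=; apply: mulrC.
Qed.

End Functionals.

(** * Cyclic sums as defects of the O-operator identities *)

Section ODefect.
Variables (K : fieldType) (P V : vectType K) (A : ncPoisson P).
Variables (M : representation A V) (hM : rho_compatible M) (T : 'Hom(V, P)).
Let Tbar := hom_tensor T - tswap (hom_tensor T).

Definition O_defect_mul (u v : V) : P :=
  pmul A (T u) (T v) - T (repL M (T u) v + repR M (T v) u).

Definition O_defect_br (u v : V) : P :=
  pbr A (T u) (T v) - T (rep_rho M (T u) v - rep_rho M (T v) u).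

Lemma dual_repLE x (a : dual V) v : repL (dual_rep hM) x a v = a (repR M x v).
Proof. by rewrite /= !opp_lfunE dual_mapE opprK. Qed.

Lemma dual_repRE x (a : dual V) v : repR (dual_rep hM) x a v = a (repL M x v).
Proof. by rewrite /= !opp_lfunE dual_mapE opprK. Qed.

Lemma dual_rep_rhoE x (a : dual V) v :
  rep_rho (dual_rep hM) x a v = - a (rep_rho M x v).
Proof. by rewrite /= dual_mapE. Qed.

(** The signs of [- T v] and [- T w] cancel in the [P] component, but each mixed term contains just
    one of them. *)
Lemma functional_mul alpha beta gamma u v w :
  functional alpha u (pmul (semidirect (dual_rep hM))
    (Tbar (functional beta v)) (Tbar (functional gamma w))) =
  (alpha (pmul A (T v) (T w)) : K) - (gamma (T (repR M (T v) u)) : K)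
  - (beta (T (repL M (T w) u)) : K).
Proof.
have hB := pmul_bilinear A.
rewrite !hom_tensor_functional functionalE -addrA.
congr ((alpha _ : K) + _).
  by rewrite /= -!scaleN1r (bilinZl hB) (bilinZr hB) !scaleN1r opprK.
rewrite [LHS]add_lfunE dual_repLE dual_repRE.
by rewrite !comp_lfunE !linearN !opp_lfunE !linearN.
Qed.

Lemma functional_br alpha beta gamma u v w :
  functional alpha u (pbr (semidirect (dual_rep hM))
    (Tbar (functional beta v)) (Tbar (functional gamma w))) =
  (alpha (pbr A (T v) (T w)) : K) + (gamma (T (rep_rho M (T v) u)) : K)
  - (beta (T (rep_rho M (T w) u)) : K).
Proof.
have hB := pbr_bilinear A.
rewrite !hom_tensor_functional functionalE -addrA.
congr ((alpha _ : K) + _).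
  by rewrite /= -!scaleN1r (bilinZl hB) (bilinZr hB) !scaleN1r opprK.
rewrite [LHS]add_lfunE [X in _ + X = _]opp_lfunE !dual_rep_rhoE.
(* The sign in the dual action cancels the one in [- T v] or [- T w]. *)
have rhoN (a : dual P) x y :
    - (a \o T)%VF (rep_rho M (- x) y) = a (T (rep_rho M x y)).
  by rewrite comp_lfunE !linearN opp_lfunE !linearN /= opprK.
by rewrite !rhoN.
Qed.

(** Collect by functional: [alpha] gets the product of [T v] and [T w] from its own term, the [repR]
    correction from the [beta] term and the [repL] correction from the [gamma] term. The other two
    follow cyclically. *)
Lemma cyclic_sum_mul alpha beta gamma u v w :
  cyclic_sum Tbar (pmul (semidirect (dual_rep hM)))
    (functional alpha u) (functional beta v) (functional gamma w) =
  (alpha (O_defect_mul v w) : K) + (beta (O_defect_mul w u) : K)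
  + (gamma (O_defect_mul u v) : K).
Proof.
rewrite /cyclic_sum !functional_mul /O_defect_mul !(linearB, linearD) /=.
ring.
Qed.

Lemma cyclic_sum_br alpha beta gamma u v w :
  cyclic_sum Tbar (pbr (semidirect (dual_rep hM)))
    (functional alpha u) (functional beta v) (functional gamma w) =
  (alpha (O_defect_br v w) : K) + (beta (O_defect_br w u) : K)
  + (gamma (O_defect_br u v) : K).
Proof.
rewrite /cyclic_sum !functional_br /O_defect_br !(linearB, linearD) /=.
ring.
Qed.

Lemma O_operator_defect :
  O_operator M T <-> forall u v, O_defect_mul u v = 0 /\ O_defect_br u v = 0.
Proof.
split=> H u v; have [E F] := H u v.
  by rewrite /O_defect_mul /O_defect_br E F !subrr.
by split; apply/eqP; rewrite -subr_eq0; apply/eqP.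
Qed.

Lemma PYBE_O_operator : PYBE (semidirect (dual_rep hM)) Tbar <-> O_operator M T.
Proof.
rewrite O_operator_defect (PYBE_cyclic_sum _ (hom_tensor_skew T)).
split=> [H u v|H f g h].
  (* Taking zero for [beta] and [gamma] leaves only [alpha] of the defect at [u], [v]; as [alpha] is
     arbitrary, the defect vanishes. *)
  by split; apply: dual_separates => alpha;
    have [] := H (functional alpha 0) (functional 0 u) (functional 0 v);
    rewrite cyclic_sum_mul cyclic_sum_br !zero_lfunE !addr0.
have [alpha [u ->]] := functional_surj f.
have [beta [v ->]] := functional_surj g.
have [gamma [w ->]] := functional_surj h.
rewrite cyclic_sum_mul cyclic_sum_br.
have [-> ->] := H v w; have [-> ->] := H w u; have [-> ->] := H u v.
by rewrite !linear0 !addr0.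
Qed.

End ODefect.

Theorem theorem5p24 (K : closedFieldType) (charK : [pchar K] =i pred0)
    (P V : vectType K) (A : ncPoisson P) (cohA : coherent A)
    (M : representation A V) (hM : rho_compatible M) (T : 'Hom(V, P)) :
  let Tbar := hom_tensor T - tswap (hom_tensor T) in
  (skew_symmetric Tbar /\ PYBE (semidirect (dual_rep hM)) Tbar)
  <-> O_operator M T.
Proof.
(* Skew-symmetry of [Tbar] is automatic, so the equivalence is that of the Yang-Baxter equation with
   the O-operator identities. *)
move=> Tbar; rewrite -(PYBE_O_operator hM T); split=> [[] //|?].
by split=> //; apply: hom_tensor_skew.
Qed.
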